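(* Let $K/F$ be a Galois extension of number fields (not necessarily abelian) with Galois group $G_{K/F}$, and assume that the class group $C\ell(F)$ is trivial. Let $f \in \mathbf{R}_{K/F}$. Let $H_f^1,\dots,H_f^r$ be all the cyclic subgroups of $G_{K/F}$ of order $f$, put $H_f = \bigcap_{i=1}^r H_f^i$, let $\{\sigma_1,\dots,\sigma_t\}$ be a set of representatives of the (left) cosets of $H_f$ in $G_{K/F}$, and set $\theta_f = \sum_{i=1}^t \sigma_i \in \mathbb{Z}[G_{K/F}]$. Then $\theta_f$ annihilates the class group $C\ell(K)$ (with $\mathbb{Z}[G_{K/F}]$ acting on $C\ell(K)$ via the natural Galois action on ideals).
   Context: For an extension of number fields $K/F$, the residue degree of a prime ideal $\mathfrak{P}$ of $K$ is $f(\mathfrak{P}|\mathfrak{p}) = [\mathcal{O}_K/\mathfrak{P} : \mathcal{O}_F/\mathfrak{p}]$ with $\mathfrak{p}=\mathfrak{P}\cap\mathcal{O}_F$. Convention: all prime ideals considered are unramified in $K/F$. $\mathbf{R}_{K/F}$ is the set of positive integers $f$ such that $C\ell(K)$ is generated by the ideal classes of (unramified) prime ideals of $K$ of residue degree $f$ for $K/F$. *)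

(* Defs.v *)
From HB Require Import structures.
From mathcomp Require Import all_boot all_order all_algebra all_fingroup.
From mathcomp Require Import all_solvable all_field.
From mathcomp Require Import boolp classical_sets.

Set Implicit Arguments.
Unset Strict Implicit.
Unset Printing Implicit Defensive.

Import GRing.Theory.

Local Open Scope classical_set_scope.
Local Open Scope ring_scope.
Local Open Scope quotient_scope.

(* Number fields are the subfields of an ambient finite extension L of rat;
   ideals and fractional ideals are subsets of L, and O_E is integers E. *)

Section FractionalIdeals.
Variables (L : fieldExtType rat) (E : {subfield L}).
Implicit Types A B C : set L.

Definition integers : set L :=
  [set x | x \in E /\ integralOver (intr : int -> L) x].

Definition submodule A : Prop :=
  [/\ A `<=` [set x | x \in E], A 0,
      forall x y, A x -> A y -> A (x + y)
    & forall a x, integers a -> A x -> A (a * x)].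

Definition fractional A : Prop :=
  [/\ submodule A, exists2 x, A x & x != 0
    & exists d, [/\ integers d, d != 0 & forall x, A x -> integers (d * x)]].

Definition ideal_mul A B : set L :=
  [set x | exists2 s : seq (L * L),
     forall p, p \in s -> A p.1 /\ B p.2 & x = \sum_(p <- s) p.1 * p.2].

Definition ideal_exp A n : set L := iter n (ideal_mul A) integers.

Definition principal_set (a : L) : set L := [set a * x | x in integers].

Definition invertible A : Prop :=
  exists2 B, fractional B & ideal_mul A B = integers.

Lemma integers0 : integers 0.
Proof. by split; [exact: mem0v | exact: integral0]. Qed.

Lemma integers1 : integers 1.
Proof. by split; [exact: mem1v | exact: integral1]. Qed.

Lemma integersD x y : integers x -> integers y -> integers (x + y).
Proof. by case=> Ex ix [Ey iy]; split; [exact: rpredD | exact: integral_add]. Qed.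

Lemma integersM x y : integers x -> integers y -> integers (x * y).
Proof. by case=> Ex ix [Ey iy]; split; [exact: rpredM | exact: integral_mul]. Qed.

Lemma fractional_integers : fractional integers.
Proof.
split; first split.
- by move=> x [].
- exact: integers0.
- exact: integersD.
- by move=> a x; exact: integersM.
- by exists 1; [exact: integers1 | exact: oner_neq0].
- exists 1; split; [exact: integers1 | exact: oner_neq0 |].
  by move=> x; rewrite mul1r.
Qed.

Lemma mem_ideal_mul A B a b : A a -> B b -> ideal_mul A B (a * b).
Proof.
move=> Aa Bb; exists [:: (a, b)]; last by rewrite big_seq1.
by move=> p; rewrite inE => /eqP ->.
Qed.

Lemma ideal_mul0 A B : ideal_mul A B 0.
Proof. by exists [::]; rewrite ?big_nil. Qed.

Lemma ideal_mulD A B x y :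
  ideal_mul A B x -> ideal_mul A B y -> ideal_mul A B (x + y).
Proof.
case=> s sP -> [t tP ->]; exists (s ++ t); last by rewrite big_cat.
by move=> p; rewrite mem_cat => /orP[/sP | /tP].
Qed.

Lemma ideal_mul_sub A B C : C 0 -> (forall x y, C x -> C y -> C (x + y)) ->
  (forall a b, A a -> B b -> C (a * b)) -> ideal_mul A B `<=` C.
Proof.
move=> C0 CD CM x [s sP ->]; rewrite big_seq.
by apply: (big_ind C) => // p /sP[Aa Bb]; exact: CM.
Qed.

Lemma ideal_mulC A B : ideal_mul A B = ideal_mul B A.
Proof.
have sub X Y : ideal_mul X Y `<=` ideal_mul Y X.
  apply: ideal_mul_sub; [exact: ideal_mul0 | exact: ideal_mulD |].
  by move=> a b Xa Yb; rewrite mulrC; exact: mem_ideal_mul.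
by apply/seteqP; split; exact: sub.
Qed.

Lemma ideal_mulA A B C :
  ideal_mul A (ideal_mul B C) = ideal_mul (ideal_mul A B) C.
Proof.
have sub X Y Z :
    ideal_mul X (ideal_mul Y Z) `<=` ideal_mul (ideal_mul X Y) Z.
  apply: ideal_mul_sub; [exact: ideal_mul0 | exact: ideal_mulD |].
  move=> a b Xa; move: b; apply: ideal_mul_sub.
  - by rewrite mulr0; exact: ideal_mul0.
  - by move=> x y hx hy; rewrite mulrDr; exact: ideal_mulD.
  - move=> b c Yb Zc; rewrite mulrA; apply: mem_ideal_mul => //.
    exact: mem_ideal_mul.
apply/seteqP; split; first exact: sub.
rewrite ideal_mulC (ideal_mulC A B) (ideal_mulC A) (ideal_mulC B C).
exact: sub.
Qed.

Lemma ideal_mul1 A : submodule A -> ideal_mul integers A = A.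
Proof.
case=> _ A0 AD AM; apply/seteqP; split; first exact: ideal_mul_sub.
by move=> x Ax; rewrite -[x]mul1r; apply: mem_ideal_mul => //; exact: integers1.
Qed.

Lemma fractional_mul A B :
  fractional A -> fractional B -> fractional (ideal_mul A B).
Proof.
case=> -[AE A0 AD AM] [a Aa a0] [c [Oc c0 cA]].
case=> -[BE B0 BD BM] [b Bb b0] [d [Od d0 dB]].
split; first split.
- apply: ideal_mul_sub; first exact: mem0v.
    by move=> x y; exact: rpredD.
  by move=> x y /AE Ex /BE Ey; exact: rpredM.
- exact: ideal_mul0.
- exact: ideal_mulD.
- move=> e x Oe; move: x; apply: ideal_mul_sub.
  + by rewrite mulr0; exact: ideal_mul0.
  + by move=> x y hx hy; rewrite mulrDr; exact: ideal_mulD.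
  + by move=> x y Ax By; rewrite mulrA; apply: mem_ideal_mul => //; exact: AM.
- by exists (a * b); [exact: mem_ideal_mul | rewrite mulf_neq0].
- exists (c * d); split; [exact: integersM | by rewrite mulf_neq0 |].
  apply: ideal_mul_sub.
  + by rewrite mulr0; exact: integers0.
  + by move=> x y hx hy; rewrite mulrDr; exact: integersD.
  + by move=> x y Ax By; rewrite mulrACA; apply: integersM; [exact: cA | exact: dB].
Qed.

Definition frac_ideal_pred : pred (set L) :=
  fun A => `[< fractional A /\ invertible A >].

(* The group of fractional ideals, taken as the units of the monoid of nonzero
   fractional ideals. Since O_E is a Dedekind domain, these are all of them. *)
Record frac_ideal := FracIdeal {
  frac_set : set L;
  frac_idealP : frac_ideal_pred frac_set
}.

HB.instance Definition _ := [isSub for frac_set].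
HB.instance Definition _ := [Choice of frac_ideal by <:].

Lemma frac_inj (I J : frac_ideal) : frac_set I = frac_set J -> I = J.
Proof. exact: val_inj. Qed.

Lemma fracP (I : frac_ideal) : fractional (frac_set I).
Proof. by case: I => A /= /asboolP[]. Qed.

Lemma frac_inv (I : frac_ideal) :
  exists J, ideal_mul (frac_set I) (frac_set J) = integers.
Proof.
case: I => A /=; case/asboolP=> fA [B fB AB].
have hB : frac_ideal_pred B.
  by apply/asboolP; split=> //; exists A; rewrite // ideal_mulC.
by exists (FracIdeal hB).
Qed.

Fact frac_one_subproof : frac_ideal_pred integers.
Proof.
apply/asboolP; split; first exact: fractional_integers.
exists integers; first exact: fractional_integers.
by rewrite ideal_mul1; case: fractional_integers.
Qed.

Fact frac_mul_subproof (I J : frac_ideal) :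
  frac_ideal_pred (ideal_mul (frac_set I) (frac_set J)).
Proof.
apply/asboolP; split; first by apply: fractional_mul; exact: fracP.
have [I' II'] := frac_inv I; have [J' JJ'] := frac_inv J.
exists (ideal_mul (frac_set J') (frac_set I')).
  by apply: fractional_mul; exact: fracP.
rewrite -ideal_mulA (ideal_mulA (frac_set J)) JJ' ideal_mul1 //.
by case: (fracP I').
Qed.

Definition frac_one := FracIdeal frac_one_subproof.
Definition frac_mul I J := FracIdeal (frac_mul_subproof I J).
Definition frac_invi I : frac_ideal := projT1 (cid (frac_inv I)).

Fact frac_mulA : associative frac_mul.
Proof. by move=> I J K; apply: frac_inj; exact: ideal_mulA. Qed.

Fact frac_mulC : commutative frac_mul.
Proof. by move=> I J; apply: frac_inj; exact: ideal_mulC. Qed.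

Fact frac_mul1 : left_id frac_one frac_mul.
Proof. by move=> I; apply: frac_inj; apply: ideal_mul1; case: (fracP I). Qed.

Fact frac_mulV : left_inverse frac_one frac_invi frac_mul.
Proof.
by move=> I; rewrite frac_mulC; apply: frac_inj; exact: (projT2 (cid (frac_inv I))).
Qed.

(* Multiplication of ideals is the addition of this Z-module. *)
HB.instance Definition _ :=
  GRing.isZmodule.Build frac_ideal frac_mulA frac_mulC frac_mul1 frac_mulV.

Definition principal (I : frac_ideal) : bool :=
  `[< exists a, [/\ a \in E, a != 0 & frac_set I = principal_set a] >].

Lemma principal_mul a B : submodule B ->
  ideal_mul (principal_set a) B = [set a * x | x in B].
Proof.
case=> _ B0 BD BM; apply/seteqP; split.
  apply: ideal_mul_sub.
  - by exists 0; rewrite ?mulr0.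
  - by move=> _ _ [x Bx <-] [y By <-]; exists (x + y); [exact: BD | rewrite mulrDr].
  - move=> _ y [x Ox <-] By; exists (x * y); [exact: BM | by rewrite mulrA].
move=> _ [x Bx <-]; apply: mem_ideal_mul => //.
by exists 1; [exact: integers1 | rewrite mulr1].
Qed.

Fact principal_zmod_closed : zmod_closed principal.
Proof.
split.
  apply/asboolP; exists 1; split; [exact: mem1v | exact: oner_neq0 |].
  apply/seteqP; split=> x; first by move=> Ox; exists x; rewrite // mul1r.
  by case=> y Oy <-; rewrite mul1r.
move=> I J /asboolP[a [Ea a0 Ia]] /asboolP[b [Eb b0 Jb]].
have [sJ' _ _] := fracP (- J).
have JV : [set b * x | x in frac_set (- J)] = integers.
  rewrite -principal_mul // -Jb.
  exact (congr1 frac_set (subrr J : J - J = frac_one)).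
apply/asboolP; exists (a / b); split.
- by rewrite rpred_div.
- by rewrite mulf_neq0 ?invr_eq0.
rewrite -[LHS]/(ideal_mul (frac_set I) (frac_set (- J))) Ia principal_mul //.
rewrite /principal_set -JV; apply/seteqP; split.
  move=> _ [x J'x <-]; exists (b * x); first by exists x.
  by rewrite mulrA divfK.
by move=> _ [_ [x J'x <-] <-]; exists x; rewrite // mulrA divfK.
Qed.

HB.instance Definition _ :=
  GRing.isZmodClosed.Build frac_ideal principal principal_zmod_closed.

Definition class_group :=
  {ideal_quot GRing.ZmodClosed.clone frac_ideal principal _}.

Definition ideal_class (I : frac_ideal) : class_group := \pi_class_group I.

Definition class_of_set A (c : class_group) : Prop :=
  exists2 I, frac_set I = A & c = ideal_class I.

Definition prime_ideal (P : set L) : Prop :=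
  [/\ submodule P, P `<=` integers, exists2 x, P x & x != 0, ~ P 1
    & forall x y, integers x -> integers y -> P (x * y) -> P x \/ P y].

Definition ideal_dvd A B : Prop :=
  exists2 C, submodule C /\ C `<=` integers & B = ideal_mul A C.

End FractionalIdeals.

Section Decomposition.
Variables (L : fieldExtType rat) (F K : {subfield L}).
Implicit Type P : set L.

Definition prime_below P : set L := P `&` integers F.

Definition extended_below P : set L := ideal_mul (prime_below P) (integers K).

Definition ramification_index P (e : nat) : Prop :=
  ideal_dvd K (ideal_exp K P e) (extended_below P)
  /\ ~ ideal_dvd K (ideal_exp K P e.+1) (extended_below P).

(* Residue fields are finite, so there is no separability condition. *)
Definition unramified P : Prop := ramification_index P 1.

(* The classes of b_0, ..., b_(f - 1) form a basis of O_K / P as a vector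
   space over O_F / (prime_below P). *)
Definition residue_basis P f (b : 'I_f -> L) : Prop :=
  [/\ forall i, integers K (b i),
      forall x, integers K x ->
        exists2 c : 'I_f -> L, forall i, integers F (c i)
          & P (x - \sum_i c i * b i)
    & forall c : 'I_f -> L, (forall i, integers F (c i)) ->
        P (\sum_i c i * b i) -> forall i, prime_below P (c i)].

Definition residue_degree P f : Prop := exists b, @residue_basis P f b.

Definition is_subgroup (V : zmodType) (S : set V) : Prop :=
  S 0 /\ forall x y, S x -> S y -> S (x - y).

Definition generates (V : zmodType) (S : set V) : Prop :=
  smallest (@is_subgroup V) S = setT.

Definition degree_classes f : set (class_group K) :=
  [set c | exists P, [/\ prime_ideal K P, unramified P, residue_degree P f
                       & class_of_set P c]].

(* The set R_{K/F}. *)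
Definition generating_degrees : set nat :=
  [set f | (0 < f)%N /\ generates (degree_classes f)].

End Decomposition.

Section GaloisAction.
Variables (L : splittingFieldType rat) (K : {subfield L}).
Implicit Types (s : gal_of K) (A B : set L).

Lemma integers_gal s x : integers K x -> integers K (s x).
Proof.
case=> Kx [p mp px]; split; first exact: memv_gal.
exists p => //; have <- : map_poly s (map_poly intr p) = map_poly intr p.
  by apply/polyP => i; rewrite !coef_map /= rmorph_int.
by rewrite fmorph_root.
Qed.

Lemma gal_submodule s A : submodule K A -> submodule K (s @` A).
Proof.
case=> AK A0 AD AM; split.
- by move=> _ [x /AK Kx <-]; exact: memv_gal.
- by exists 0; rewrite ?rmorph0.
- by move=> _ _ [x Ax <-] [y Ay <-]; exists (x + y); [exact: AD | rewrite rmorphD].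
- move=> a _ Oa [x Ax <-]; exists (s^-1%g a * x).
    by apply: AM => //; exact: integers_gal.
  by rewrite rmorphM /= -galM ?mulVg ?gal_id //; case: Oa.
Qed.

Lemma gal_integers s : s @` integers K = integers K.
Proof.
apply/seteqP; split=> [_ [x Ox <-] | x Ox]; first exact: integers_gal.
exists (s^-1%g x); first exact: integers_gal.
by rewrite -galM ?mulVg ?gal_id //; case: Ox.
Qed.

Lemma gal_ideal_mul s A B :
  s @` ideal_mul A B = ideal_mul (s @` A) (s @` B).
Proof.
apply/seteqP; split.
  move=> _ [x ABx <-]; move: x ABx; apply: ideal_mul_sub => [|x y hx hy|x y Ax By].
  - by rewrite rmorph0; exact: ideal_mul0.
  - by rewrite rmorphD; exact: ideal_mulD.
  - by rewrite rmorphM; apply: mem_ideal_mul; [exists x | exists y].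
apply: ideal_mul_sub.
- by exists 0; [exact: ideal_mul0 | rewrite rmorph0].
- move=> _ _ [x hx <-] [y hy <-]; exists (x + y); last by rewrite rmorphD.
  exact: ideal_mulD.
- move=> _ _ [x hx <-] [y hy <-]; exists (x * y); last by rewrite rmorphM.
  exact: mem_ideal_mul.
Qed.

Lemma gal_fractional s A : fractional K A -> fractional K (s @` A).
Proof.
case=> sA [x Ax x0] [d [Od d0 dA]]; split; first exact: gal_submodule.
  by exists (s x); [exists x | rewrite fmorph_eq0].
exists (s d); split; [exact: integers_gal | by rewrite fmorph_eq0 |].
by move=> _ [y Ay <-]; rewrite -rmorphM; apply: integers_gal; exact: dA.
Qed.

Fact gal_frac_subproof s (I : frac_ideal K) : frac_ideal_pred K (s @` frac_set I).
Proof.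
apply/asboolP; split; first by apply: gal_fractional; exact: fracP.
have [J IJ] := frac_inv I; exists (s @` frac_set J).
  by apply: gal_fractional; exact: fracP.
by rewrite -gal_ideal_mul IJ gal_integers.
Qed.

Definition gal_frac s (I : frac_ideal K) := FracIdeal (gal_frac_subproof s I).

Definition gal_class s (c : class_group K) : class_group K :=
  ideal_class (gal_frac s (generic_quotient.repr c)).

Lemma gal_fracB s : {morph gal_frac s : I J / I - J}.
Proof.
have D : {morph gal_frac s : I J / I + J}.
  by move=> I J; apply: frac_inj; exact: gal_ideal_mul.
move=> I J; apply: (addIr (gal_frac s J)).
by rewrite -D !subrK.
Qed.

Lemma gal_class_pi s I : gal_class s (ideal_class I) = ideal_class (gal_frac s I).
Proof.
apply/eqP; rewrite -Quotient.idealrBE -gal_fracB.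
have /asboolP[a [Ka a0 Ia]] : generic_quotient.repr (ideal_class I) - I \in @principal _ K.
  by rewrite Quotient.idealrBE reprK.
apply/asboolP; exists (s a); split; [exact: memv_gal | by rewrite fmorph_eq0 |].
rewrite -[LHS]/(s @` frac_set (generic_quotient.repr (ideal_class I) - I)) Ia.
apply/seteqP; split.
  move=> _ [_ [x Ox <-] <-]; exists (s x); first exact: integers_gal.
  by rewrite rmorphM.
move=> _ [x Ox <-]; move: Ox; rewrite -{1}(gal_integers s) => -[y Oy <-].
by exists (a * y); [exists y | rewrite rmorphM].
Qed.

(* The integral group ring of Aut(K): formal sums of automorphisms, given by
   their coefficients. For a Galois subextension, Z['Gal(K / F)] consists of
   the elements supported on 'Gal(K / F). *)
Definition group_ring := {ffun gal_of K -> int}.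

Definition group_elt s : group_ring := [ffun t => (t == s)%:R].

Definition group_ring_act (z : group_ring) (c : class_group K) : class_group K :=
  \sum_s gal_class s c *~ z s.

Definition annihilates_class_group (z : group_ring) : Prop :=
  forall c, group_ring_act z c = 0.

End GaloisAction.

Section Theta.
Variables (L : splittingFieldType rat) (F K : {subfield L}).

(* The intersection is taken inside 'Gal(K / F). *)
Definition cyclic_core (f : nat) : {set gal_of K} :=
  ('Gal(K / F) :&: \bigcap_(C : {group gal_of K} |
     [&& C \subset 'Gal(K / F)%g, cyclic C & #|C| == f]) C)%g.

(* As galM reads (x * y) a = y (x a), the cosets s o H for the composition of
   automorphisms are the right cosets H :* s. *)
Definition coset_reps (H T : {set gal_of K}) : bool :=
  is_transversal T (rcosets H 'Gal(K / F)%g) 'Gal(K / F)%g.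

Definition theta (T : {set gal_of K}) : group_ring K :=
  \sum_(s in T) group_elt s.

End Theta.

(* Main.v *)
Require Import Defs.
From HB Require Import structures.
From mathcomp Require Import all_boot all_order all_algebra all_fingroup.
From mathcomp Require Import all_solvable all_field.
From mathcomp Require Import boolp classical_sets.

Set Implicit Arguments.
Unset Strict Implicit.
Unset Printing Implicit Defensive.

Import GRing.Theory Num.Theory.

Local Open Scope ring_scope.
Local Open Scope quotient_scope.

(** Let I be an invertible prime P of K of residue degree f, p its trace on F,
    G = Gal(K/F), D the decomposition group of P and Q the product of the
    distinct conjugates of P.

    - Lifting a generator of the residue field of P to an element x lying in all
      the conjugates of P other than P, one finds s in G with s x = x^q mod P,
      where q is the size of the residue field of p. Then s is in D, and f divides
      the order of s, so D contains a cyclic group of order f. Hence H_f is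
      contained in D, and the product of the s P over representatives s of the
      cosets of H_f is Q^[D : H_f].

    - As P is unramified, some a in p is not in P^2. Then a Q^-1 is an integral,
      G-stable ideal not contained in P; if c is in it but not in P, then some
      coefficient of the product of the X - s c is in (a Q^-1) /\ O_F but not in
      p. So p is locally principal, hence invertible, hence p = w O_F as Cl(F)
      is trivial. The same argument with a = w shows that w Q^-1 contains 1 (p is
      maximal), so that Q = w O_K is principal. *)

(** * Residue fields *)

Section FiniteDomain.

Variable R : comNzRingType.
Hypothesis domR : GRing.integral_domain_axiom R.

(** A classically chosen inverse, with nonunits sent to themselves, supplies the unit ring structure
    that the integral domain interface demands. *)
Let isU (x : R) : bool := `[< exists y, y * x = 1 >].
Let inv (x : R) : R :=
  if pselect (exists y, y * x = 1) is left xU then projT1 (cid xU) else x.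

Let mulVx : {in isU, left_inverse 1 inv *%R}.
Proof.
move=> x /asboolP xU; rewrite /inv; case: pselect => // xU'.
by case: cid.
Qed.

Let unitPl (x y : R) : y * x = 1 -> isU x.
Proof. by move=> yx; apply/asboolP; exists y. Qed.

Let invr_out : {in [predC isU], inv =1 id}.
Proof. by move=> x /asboolPn nU; rewrite /inv; case: pselect. Qed.

(** The product of the nonzero [p i] is a nonzero polynomial vanishing on all of R, so R has fewer
    elements than its size; a finite domain is a field. *)
Lemma finite_domain_field (I : finType) (p : I -> {poly R}) :
  (forall x, exists2 i, p i != 0 & root (p i) x) ->
  exists (k : finFieldType) (h : {rmorphism R -> k}), bijective h.
Proof.
move=> px.
pose uC := GRing.ComNzRing_hasMulInverse.Build R mulVx unitPl invr_out.
pose uR : comUnitRingType := HB.pack R uC.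
pose iC := GRing.ComUnitRing_isIntegral.Build uR domR.
pose iR : idomainType := HB.pack uR iC.
pose g : {poly iR} := \prod_(i | p i != 0) p i.
have g0 : g != 0 by apply/prodf_neq0.
have gx x : root g x.
  by have [i pi0 pix] := px x; rewrite /g (bigD1 i) //= rootM pix.
(* The size of [g] bounds the duplicate-free lists; one of maximal length contains every element and
   serves as the enumeration. *)
pose P n := `[< exists2 s : seq iR, uniq s & size s = n >].
have P0 : exists n, P n by exists 0%N; apply/asboolP; exists [::].
have Pb n : P n -> (n <= size g)%N.
  move=> /asboolP[s us <-]; apply: ltnW.
  by apply: (@max_poly_roots iR g) => //; apply/allP => x _; exact: gx.
case: (ex_maxnP P0 Pb) => n /asboolP[s us sn] smax.
have sall x : x \in s.
  apply: contraT => xs; have := smax (size (x :: s)).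
  by rewrite /= sn ltnn; apply; apply/asboolP; exists (x :: s); rewrite /= ?xs //= sn.
have fs : Finite.axiom s by move=> x; rewrite count_uniq_mem ?sall.
have pK : pcancel (fun x => index x s) (fun i => nth None (map Some s) i).
  by move=> x; rewrite (nth_map (x : iR)) ?index_mem // nth_index.
pose cR : countType := HB.pack iR (isCountable.Build R pK).
pose fR : finUnitRingType := HB.pack iR cR (isFinite.Build cR fs).
pose k := @FinDomainFieldType fR domR.
pose A := GRing.isZmodMorphism.Build R k id (fun x y => erefl).
pose M := GRing.isMonoidMorphism.Build R k id (conj erefl (fun x y => erefl)).
pose h : {rmorphism R -> k} := HB.pack (id : R -> k) A M.
by exists k, h; exists id.
Qed.

End FiniteDomain.

(** * The ring O_E as a type, and its quotient by a prime *)

Section RingOfIntegers.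
Local Open Scope classical_set_scope.
Variables (L : fieldExtType rat) (E : {subfield L}).

Definition is_integer : pred L := fun x => `[< integers E x >].

Fact is_integer_subring : subring_closed is_integer.
Proof.
split=> [|x y|x y]; first by apply/asboolP; exact: integers1.
  move=> /asboolP[Ex ix] /asboolP[Ey iy]; apply/asboolP.
  by split; [exact: rpredB | exact: integral_sub].
by move=> /asboolP Ix /asboolP Iy; apply/asboolP; exact: integersM.
Qed.

HB.instance Definition _ := GRing.isSubringClosed.Build L is_integer is_integer_subring.

Record integer_ring := IntegerRing { int_val : L; _ : int_val \in is_integer }.
HB.instance Definition _ := [isSub for int_val].
HB.instance Definition _ := [Choice of integer_ring by <:].
HB.instance Definition _ := [SubChoice_isSubComNzRing of integer_ring by <:].

Definition to_int x (Ox : integers E x) : integer_ring := IntegerRing (asboolT Ox).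

Variables (P : set L) (primeP : prime_ideal E P).

(** Carrying the primality proof as an argument lets the ideal structure be inferred from the
    predicate. *)
Definition in_prime (_ : prime_ideal E P) : pred integer_ring :=
  fun x => `[< P (val x) >].

Lemma integersK (x : integer_ring) : integers E (val x).
Proof. by case: x => x /= /asboolP. Qed.

Fact in_prime_idealr : idealr_closed (in_prime primeP).
Proof.
have [[_ P0 PD PM] _ _ P1 _] := primeP; split; first exact/asboolP.
  exact/asboolPn.
move=> a x y /asboolP Px /asboolP Py.
by apply/asboolP; apply: PD => //; apply: PM => //; exact: integersK.
Qed.

End RingOfIntegers.

Section ResidueField.
Variables (L : fieldExtType rat) (E : {subfield L}).
Variables (P : set L) (primeP : prime_ideal E P).
HB.instance Definition _ :=
  isIdealr.Build (integer_ring E) (in_prime primeP) (in_prime_idealr primeP).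

Let residue_ring := {ideal_quot (in_prime primeP : idealr (integer_ring E))}.

Fact residue_ring_domain : GRing.integral_domain_axiom residue_ring.
Proof.
elim/quotW=> x; elim/quotW=> y; rewrite -rmorphM /= => /eqP.
have pi0 z : (\pi_residue_ring z == 0) = (z \in in_prime primeP).
  by rewrite -(rmorph0 \pi_residue_ring) -Quotient.idealrBE subr0.
rewrite !pi0 => /asboolP Pxy; have [_ _ _ _ /(_ _ _ _ _ Pxy)] := primeP.
by case=> [||Pz|Pz]; try exact: integersK; apply/orP; [left | right]; apply/asboolP.
Qed.

End ResidueField.

(** Clear denominators in the minimal polynomial over the rationals and divide by the content.
    Content 1 is what keeps [q] nonzero modulo every m > 1. *)
Lemma primitive_poly_root (L : fieldExtType rat) (x : L) :
  exists q : {poly int}, [/\ zcontents q = 1, (size q <= (\dim {:L}).+1)%N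
    & root (map_poly intr q) x].
Proof.
have /polyOver1P[p Ep] := minPolyOver 1 x.
have p0 : p != 0.
  by rewrite -(map_poly_eq0 (in_alg L)) -Ep monic_neq0 ?monic_minPoly.
have sp : (size p <= (\dim {:L}).+1)%N.
  rewrite -(size_map_poly (in_alg L)) -Ep size_minPoly ltnS /adjoin_degree.
  by rewrite dimv1 divn1 prednK ?adim_gt0 //; apply: dimvS; exact: subvf.
have px : root (map_poly (in_alg L) p) x by rewrite -Ep root_minPoly.
have [q [a a0 Eq]] := rat_poly_scale p.
have q0 : q != 0.
  by apply: contraNneq p0 => q0; rewrite Eq q0 rmorph0 scaler0.
have sq : size q = size p.
  rewrite Eq size_scale ?invr_eq0 ?intr_eq0 // size_map_inj_poly //.
  exact: intr_inj.
have qx : root (map_poly intr q) x.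
  move: px; rewrite Eq linearZ /= rootZ; last first.
    by rewrite scaler_eq0 oner_eq0 orbF invr_eq0 intr_eq0.
  by rewrite -map_poly_comp (eq_map_poly (g := intr)) // => z /=; rewrite scaler_int.
exists (zprimitive q); split.
- by rewrite zcontents_primitive q0.
- by rewrite size_zprimitive sq.
- move: qx; rewrite {1}(zpolyEprim q) map_polyZ rootZ //=.
  by rewrite -scaler_int scaler_eq0 oner_eq0 orbF intr_eq0 zcontents_eq0.
Qed.

(** In an integral equation of x, the constant coefficient is a multiple of x; if it vanishes, a
    factor X is removed first. *)
Lemma rational_multiple (L : fieldExtType rat) (E : {subfield L}) (x : L) :
  integers E x -> x != 0 ->
  exists2 m : nat, (0 < m)%N & exists2 y, integers E y & m%:R = y * x.
Proof.
move=> Ox x0; have [p mp px] := Ox.2.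
suff [m m0 [y Oy my]] : exists2 m : int, m != 0 &
    exists2 y, integers E y & m%:~R = y * x.
  case: m m0 my => m m0 my; first by exists m; rewrite ?lt0n //; exists y.
  exists m.+1 => //; exists (- y); last by rewrite mulNr -my NegzE mulrNz opprK.
  by split; [rewrite rpredN; case: Oy | apply: integral_opp; case: Oy].
have := monic_neq0 mp; move: px; elim/poly_ind: {mp}p => [|q c IH]; first by rewrite eqxx.
have Oq : integers E (map_poly intr q).[x].
  split; last by apply: integral_horner Ox.2 => z /(nthP 0)[i _ <-];
    rewrite coef_map; exact: integral_id.
  by apply: rpred_horner Ox.1; apply/polyOverP => i; rewrite coef_map /= rpred_int.
have [-> | c0 px _] := eqVneq c 0.
  rewrite addr0 rmorphM /= map_polyX rootM rootX (negPf x0) orbF mulf_eq0.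
  by rewrite polyX_eq0 orbF; exact: IH.
exists (- c); first by rewrite oppr_eq0.
exists (map_poly intr q).[x] => //.
move/rootP: px; rewrite rmorphD rmorphM /= map_polyX map_polyC /= !hornerE => /eqP.
by rewrite addr_eq0 mulrNz => /eqP ->.
Qed.

Lemma residue_field (L : fieldExtType rat) (E : {subfield L}) (P : set L) :
  prime_ideal E P ->
  exists (k : finFieldType) (h : {rmorphism integer_ring E -> k}),
    (forall z, exists x, h x = z) /\ (forall x, h x = 0 <-> P (val x)).
Proof.
move=> primeP; pose R := {ideal_quot (in_prime primeP : idealr (integer_ring E))}.
have [[_ P0 PD PM] PO [x Px x0] P1 _] := primeP.
pose pi : {rmorphism integer_ring E -> R} := \pi_R.
have pi0 z : pi z = 0 <-> P (val z).
  rewrite -(rmorph0 pi) /pi; split=> [/eqP|Pz].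
    by rewrite -Quotient.idealrBE subr0 => /asboolP.
  by apply/eqP; rewrite -Quotient.idealrBE subr0; apply/asboolP.
have [m m_gt0 Pm] : exists2 m, (0 < m)%N & P m%:R.
  have [m m0 [y Oy my]] := rational_multiple (PO _ Px) x0.
  by exists m; rewrite // my; exact: PM.
(* A primitive integer polynomial killing an element is nonzero modulo the
   least positive integer m of P, so every class of O_E / P is a root of one of
   the finitely many nonzero polynomials of bounded degree with coefficients in
   [0, m). *)
have exm : exists m, (0 < m)%N && `[< P m%:R >].
  by exists m; rewrite m_gt0; apply/asboolP.
case: (ex_minnP exm) => {m m_gt0 Pm exm} m /andP[m_gt0 /asboolP Pm] mmin.
have m0 : m%:R = 0 :> R.
  by rewrite -(rmorph_nat pi); apply/pi0; rewrite rmorph_nat.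
(* The second conjunct records that only multiples of m get the representative 0. *)
have mint (c : int) : exists2 i : 'I_m, c%:~R = i%:R :> R & i = 0%N :> nat -> (m %| c)%Z.
  have m0z : (m : int) != 0 by rewrite -lt0n.
  have c_ge0 := modz_ge0 c m0z; have := ltz_pmod c (m_gt0 : (0 < (m : int))%R).
  rewrite -{1}(gez0_abs c_ge0) => cm.
  exists (Ordinal (cm : (`|(c %% m)%Z| < m)%N)) => /=.
    rewrite {1}(divz_eq c m) rmorphD rmorphM /= -pmulrn m0 mulr0 add0r.
    by rewrite -{1}(gez0_abs c_ge0) -pmulrn.
  by move/eqP; rewrite absz_eq0 => /eqP cm0; apply/dvdz_mod0P.
pose n := \dim {:L}.
pose pol (c : {ffun 'I_n.+1 -> 'I_m}) : {poly R} := \poly_(i < n.+1) (c (inord i))%:R.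
have polP z : exists2 c, pol c != 0 & root (pol c) z.
  elim/quotW: z => y; have [q [q1 sq qy]] := primitive_poly_root (val y).
  pose c := [ffun i : 'I_n.+1 => projT1 (cid2 (mint q`_i))].
  have pol_c : pol c = map_poly intr q.
    apply/polyP => i; rewrite coef_poly coef_map /=.
    case: ltnP => i_lt; last by rewrite nth_default // (leq_trans sq).
    by rewrite ffunE inordK //; case: cid2.
  exists c; rewrite pol_c; last first.
    have : map_poly (pi \o intr) q = map_poly intr q.
      by apply: eq_map_poly => a /=; rewrite rmorph_int.
    rewrite map_poly_comp => <-; apply: (rmorph_root pi).
    apply/rootP/val_inj; rewrite [RHS]rmorph0.
    move/rootP: qy => <-; rewrite -horner_map -map_poly_comp.
    by congr (_.[_]); apply: eq_map_poly => a; exact: (rmorph_int val).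
  (* If q vanished modulo P, minimality of m would force every representative to be 0, so m would
     divide the content 1 and P would contain 1. *)
  apply/negP => /eqP q0; have : (m %| zcontents q)%Z.
    rewrite dvdz_contents; apply/polyOverP => i.
    have [a qa a0] := mint q`_i; apply: a0.
    have a0 : (a : nat)%:R = 0 :> R by rewrite -qa -coef_map q0 coef0.
    apply: contraTeq (ltn_ord a); rewrite -lt0n -leqNgt => a_gt0; apply: mmin.
    rewrite a_gt0; apply/asboolP; move: a0; rewrite -(rmorph_nat pi) => /pi0.
    by rewrite rmorph_nat.
  rewrite q1 dvdzE absz1 dvdn1 => /eqP m1; apply: P1.
  by have := Pm; rewrite (m1 : m = 1%N).
have [k [h [h' hK h'K]]] := finite_domain_field (@residue_ring_domain _ _ _ primeP) polP.
exists k, (h \o pi); split=> [z|z].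
  by elim/quotW: (h' z) (h'K z) => y <-; exists y.
rewrite /= -pi0; split=> [|->]; last by rewrite rmorph0.
by move/(congr1 h'); rewrite hK -(rmorph0 h) hK.
Qed.

(** * The decomposition group *)

(** Raising to the power q is additive, q being a power of the characteristic, and fixes the
    coefficients, so it commutes with evaluating g. *)
Lemma frobenius_root (k : fieldType) (q : nat) (g : {poly k}) (y : k) :
  [pchar k].-nat q -> (forall i, g`_i ^+ q = g`_i) -> root g y -> root g (y ^+ q).
Proof.
move=> kq gq /rootP gy; have q_gt0 : (0 < q)%N by case/andP: kq.
apply/rootP; have <- : g.[y] ^+ q = g.[y ^+ q].
  rewrite !horner_coef (big_morph (fun x => x ^+ q) (id1 := 0) (op1 := +%R)).
  - by apply: eq_bigr => i _; rewrite exprMn gq exprAC.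
  - by move=> a b; exact: exprDn_pchar.
  - by rewrite expr0n gtn_eqF.
by rewrite gy expr0n gtn_eqF.
Qed.

Section GalPoly.

Local Open Scope classical_set_scope.
Variables (L : splittingFieldType rat) (F K : {subfield L}).
Implicit Types (A B : set L) (s t : gal_of K).

(** For K/F Galois and x in K, this is the characteristic polynomial of x over F. *)
Definition gal_poly (x : L) : {poly L} :=
  \prod_(s in 'Gal(K / F)%g) ('X - (s x)%:P).

(** The coefficients are polynomials in integral conjugates, and the Galois group permutes the
    factors. *)
Lemma gal_poly_coef x i : galois F K -> integers K x -> integers F (gal_poly x)`_i.
Proof.
move=> galKF Ox; have Opoly : gal_poly x \is a polyOver (@is_integer _ K).
  apply: rpred_prod => s _; rewrite polyOverXsubC; apply/asboolP.
  exact: integers_gal.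
have /asboolP[Kc ic] := polyOverP Opoly i; split=> //.
rewrite -(galois_fixedField galKF); apply/fixedFieldP => // s Gs.
suff {2}<- : map_poly s (gal_poly x) = gal_poly x by rewrite coef_map.
rewrite rmorph_prod /= [RHS](reindex_inj (mulIg s)) /=.
apply: eq_big => [t|t _]; first by rewrite groupMr.
by rewrite rmorphB /= map_polyX map_polyC /= galM //; case: Ox.
Qed.

Lemma image_galM s t A : A `<=` [set x | x \in K] -> (s * t)%g @` A = t @` (s @` A).
Proof.
move=> AK; rewrite image_comp; apply: eq_imagel => x /AK Kx /=; exact: galM.
Qed.

Lemma image_gal1 A : (1%g : gal_of K) @` A = A.
Proof.
apply/seteqP; split=> [_ [x Ax <-]|x Ax]; first by rewrite gal_id.
by exists x; rewrite ?gal_id.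
Qed.

(** Iterating the inclusion up to the order n of s gives A = s^n A inside s A. *)
Lemma gal_sub_eq s A : A `<=` [set x | x \in K] -> s @` A `<=` A -> s @` A = A.
Proof.
move=> AK sA; apply/seteqP; split=> //.
have iter_sub n : (s ^+ n.+1)%g @` A `<=` s @` A.
  elim: n => [|n IHn]; first by rewrite expg1.
  rewrite expgSr image_galM //; apply: image_subset.
  exact: subset_trans IHn sA.
by have := iter_sub #[s]%g.-1; rewrite prednK ?order_gt0 // expg_order image_gal1.
Qed.

(** For a prime of K this is the decomposition group. *)
Definition stabilizer A : {set gal_of K} :=
  [set s in 'Gal(K / F)%g | `[< s @` A = A >]]%SET.

Lemma stabilizer_group A : A `<=` [set x | x \in K] -> group_set (stabilizer A).
Proof.
move=> AK; apply/group_setP; split.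
  by rewrite inE group1; apply/asboolP; exact: image_gal1.
move=> s t; rewrite !inE => /andP[Gs /asboolP sA] /andP[Gt /asboolP tA].
by rewrite groupM //; apply/asboolP; rewrite image_galM ?sA.
Qed.

End GalPoly.

(** * Lifts of Frobenius in the decomposition group *)

Section Frobenius.

Local Open Scope classical_set_scope.
Variables (L : splittingFieldType rat) (F K : {subfield L}).
Variables (P : set L).

Hypothesis galKF : galois F K.
Hypothesis primeP : prime_ideal K P.

Let subFK : (F <= K)%VS.
Proof. by case/and3P: galKF. Qed.

Lemma integersS x : integers F x -> integers K x.
Proof. by case=> Fx ix; split=> //; exact: subvP subFK x Fx. Qed.

Lemma prime_below_ideal : prime_ideal F (prime_below F P).
Proof.
have [[PK P0 PD PM] PO [x Px x0] P1 Pprime] := primeP; split.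
- split; first by move=> y [_ []].
  + by split=> //; exact: integers0.
  + by move=> y z [Py Oy] [Pz Oz]; split; [exact: PD | exact: integersD].
  + move=> a y Oa [Py Oy]; split; last exact: integersM.
    by apply: PM => //; exact: integersS.
- by move=> y [].
- have [m m_gt0 [y Oy my]] := rational_multiple (PO _ Px) x0.
  exists m%:R; first split; first by rewrite my; exact: PM.
    by split; [exact: rpred_nat | exact: integral_nat].
  by rewrite -scaler_nat scaler_eq0 oner_eq0 orbF pnatr_eq0 -lt0n.
- by case.
- move=> y z Oy Oz [/(Pprime _ _ (integersS Oy) (integersS Oz))[Py|Pz] _].
    by left.
  by right.
Qed.

(** A lift s of Frobenius induces an automorphism of order f of the residue field of P, so f divides
    the order of s and a suitable power of s has order exactly f. *)
Lemma order_stabilizer_elt f : residue_degree F K P f ->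
  exists2 s, s \in stabilizer F K P & #[s]%g = f.
Proof.
case=> b [Ob span_b free_b].
have [[PK P0 PD PM] PO [x1 Px1 x10] P1 Pprime] := primeP.
have [kF [hF [hF_surj hF0]]] := residue_field prime_below_ideal.
have [kK [hK [hK_surj hK0]]] := residue_field primeP.
set q := #|kF|.
have hKsub x y : hK x = hK y <-> P (val x - val y).
  by rewrite -[val x - val y]/(val (x - y)) -hK0 rmorphB; split=> [->|/eqP];
    rewrite ?subrr // subr_eq0 => /eqP.
(* Combinations of the basis with coefficients lifted by [r] from [kF] meet each class modulo P
   exactly once. *)
have card_kK : #|kK| = (q ^ f)%N.
  pose r z := projT1 (cid (hF_surj z)).
  have rK z : hF (r z) = z by rewrite /r; case: cid.
  pose X (c : {ffun 'I_f -> kF}) : integer_ring K :=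
    \sum_i to_int (integersS (integersK (r (c i)))) * to_int (Ob i).
  have valX c : val (X c) = \sum_i val (r (c i)) * b i.
    by rewrite rmorph_sum; apply: eq_bigr => i _; rewrite rmorphM.
  have inj_X : injective (hK \o X).
    move=> c c' /hKsub; rewrite !valX -sumrB => Pcc'; apply/ffunP => i.
    have Oc j : integers F (val (r (c j) - r (c' j))) by exact: integersK.
    rewrite -(rK (c i)) -(rK (c' i)); apply/eqP; rewrite -subr_eq0 -rmorphB.
    apply/eqP/hF0; apply: (free_b _ Oc); move: Pcc'; congr P.
    by apply: eq_bigr => j _; rewrite rmorphB mulrBl.
  rewrite -[f]card_ord -card_ffun -(card_codom inj_X); apply: eq_card => z.
  rewrite inE; apply/esym/codomP; have [x <-] := hK_surj z.
  have [c Oc Pc] := span_b _ (integersK x).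
  exists [ffun i => hF (to_int (Oc i))]; apply/hKsub; rewrite valX.
  have -> : val x - \sum_i val (r ([ffun i => hF (to_int (Oc i))] i)) * b i
      = val x - \sum_i c i * b i + \sum_i (c i - val (r (hF (to_int (Oc i))))) * b i.
    rewrite -addrA; congr (_ + _); rewrite -!sumrN -big_split /=.
    by apply: eq_bigr => i _; rewrite ffunE mulrBl addKr.
  apply: (PD) => //; apply: (big_ind P) => // i _; rewrite mulrC; apply: PM => //.
  have : hF (to_int (Oc i) - r (hF (to_int (Oc i)))) = 0 by rewrite rmorphB rK subrr.
  by case/hF0.
have q_gt1 : (1 < q)%N by exact: finNzRing_gt1.
have fixed_q (c : integer_ring K) : val c \in F -> hK c ^+ q = hK c.
  move=> Fc; rewrite -rmorphXn; apply/hKsub; rewrite rmorphXn /=.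
  have Oc : integers F (val c) by split=> //; case: (integersK c).
  have : hF (to_int Oc ^+ q - to_int Oc) = 0.
    by rewrite rmorphB rmorphXn /= expf_card subrr.
  by case/hF0; rewrite rmorphB rmorphXn.
have pnat_q : [pchar kK].-nat q.
  have [p p_pr pF] := finPcharP kF.
  have pK : p \in [pchar kK].
    rewrite inE p_pr -(rmorph_nat hK); apply/eqP/hK0; rewrite rmorph_nat.
    have : hF p%:R = 0 by rewrite rmorph_nat pcharf0.
    by move/hF0 => []; rewrite rmorph_nat.
  rewrite (eq_pnat _ (pcharf_eq pK)).
  by have := pprimeChar_pgroup pF; rewrite /pgroup cardsT.
have [u /= gen_u] := cyclicP (field_unit_group_cyclic [set: {unit kK}]%G).
have pow_u (z : kK) : z != 0 -> exists j, z = val u ^+ j.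
  move=> z0; pose v := finField_unit z0.
  have : v \in <[u]>%g by rewrite -gen_u inE.
  by case/cycleP => j vj; exists j; rewrite -FinRing.val_unitX -vj.
pose act s (x : integer_ring K) := to_int (integers_gal s (integersK x)).
(* The reduction of the characteristic polynomial of x has coefficients fixed by the power q, so the
   q-th power of its root [hK x] is again a root. At this stage s depends on x. *)
have root_gal (x : integer_ring K) : exists2 s, s \in 'Gal(K / F)%g & hK (act s x) = hK x ^+ q.
  pose g := \prod_(s in 'Gal(K / F)%g) ('X - (act s x)%:P).
  have val_g : map_poly val g = gal_poly F K (val x).
    by rewrite rmorph_prod; apply: eq_bigr => s _; exact: map_polyXsubC.
  have hg : map_poly hK g = \prod_(s in 'Gal(K / F)%g) ('X - (hK (act s x))%:P).
    by rewrite rmorph_prod; apply: eq_bigr => s _; exact: map_polyXsubC.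
  have : root (map_poly hK g) (hK x ^+ q).
    apply: frobenius_root => // [i|].
      rewrite coef_map fixed_q // -(coef_map val) val_g.
      by case: (gal_poly_coef i galKF (integersK x)).
    rewrite hg (bigD1 1%g) ?group1 //= rootM root_XsubC; apply/orP; left.
    by apply/eqP; congr (hK _); apply/val_inj; rewrite /= gal_id.
  rewrite hg => /rootP; rewrite horner_prod => /eqP/prodf_eq0[s Gs].
  by rewrite !hornerE subr_eq0 => /eqP ->; exists s.
(* Multiply elements of s P outside P, one for each s in the list with s P other than P; primality
   keeps the product outside P. *)
have avoid (l : seq (gal_of K)) : exists x, [/\ integers K x, ~ P x &
    forall s, s \in l -> s @` P <> P -> (s @` P) x].
  elim: l => [|s l [x [Ox Px lx]]]; first by exists 1; split=> //; exact: integers1.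
  have sP (t : gal_of K) y a : integers K a -> (t @` P) y -> (t @` P) (a * y).
    by move=> Oa; have [_ _ _] := gal_submodule t (And4 PK P0 PD PM); apply.
  have [sPP|sPP] := pselect (s @` P = P).
    exists x; split=> // t; rewrite inE => /orP[/eqP -> //|]; exact: lx.
  have /existsNP[y /not_implyP[sPy Py]] : ~ (s @` P `<=` P).
    by move=> /(gal_sub_eq PK).
  have Oy : integers K y by case: sPy => z /PO Oz <-; exact: integers_gal.
  exists (x * y); split; first exact: integersM.
    by move/(Pprime _ _ Ox Oy) => [].
  move=> t; rewrite inE => /orP[/eqP -> _|lt tP]; first exact: sP.
  by rewrite mulrC; apply: sP => //; exact: lx.
(* t lifts a generator of the residue field and lies in every s P other than P. *)
have [x0 [Ox0 Px0 avoid_x0]] := avoid (enum {: gal_of K}).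
have hx0 : hK (to_int Ox0) != 0 by apply/eqP => /hK0.
have [y hy] := hK_surj (val u / hK (to_int Ox0)).
pose t := y * to_int Ox0; have ht : hK t = val u by rewrite rmorphM hy divfK.
have u0 : val u != 0 by rewrite -unitfE; exact: valP.
have [s Gs st] := root_gal t.
have PKset : P `<=` [set x | x \in K] by [].
pose D := Group (stabilizer_group F PKset).
(* Were s^-1 P different from P, it would contain t, and s t would lie in P, although s t is
   congruent to the q-th power of the generator u. *)
have Ds : s \in D.
  rewrite -groupV inE groupV Gs /=; apply/asboolP; apply: contrapT => sP.
  have [_ _ _ sPM] := gal_submodule s^-1%g (And4 PK P0 PD PM).
  have s_in : s^-1%g \in enum {: gal_of K} by rewrite mem_enum.
  have /= := avoid_x0 _ s_in sP.
  move=> /(sPM _ _ (integersK y)) [z Pz zt].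
  have : hK (act s t) = 0.
    apply/hK0; rewrite /= -zt -galM; last by case: (PO _ Pz).
    by rewrite mulVg gal_id.
  by move/eqP; rewrite st ht expf_eq0 (negPf u0) andbF.
have sP z : P z -> P (s z).
  by move=> Pz; move: Ds; rewrite inE => /andP[_ /asboolP <-]; exists z.
(* Every nonzero class is a power of the class of t, and s preserves P, so the congruence for t
   extends to all x. *)
have frob x : hK (act s x) = hK x ^+ q.
  have [hx|hx] := eqVneq (hK x) 0.
    rewrite hx expr0n gtn_eqF ?(ltnW q_gt1) //.
    by apply/hK0/sP/hK0.
  have [j hxj] := pow_u _ hx.
  have : hK x = hK (t ^+ j) by rewrite rmorphXn ht.
  move=> /hKsub/sP; rewrite hxj exprAC -ht -st -rmorphXn => Ps; apply/hKsub.
  have valX z n : val (z ^+ n) = val z ^+ n :> L by exact: (rmorphXn val).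
  by move: Ps; rewrite !valX rmorphB (rmorphXn s).
have frob_iter n x : hK (act (s ^+ n)%g x) = hK x ^+ (q ^ n).
  elim: n => [|n IHn].
    by congr (hK _); apply/val_inj; rewrite /= gal_id.
  rewrite expnSr exprM -IHn -frob; congr (hK _); apply/val_inj => /=.
  by rewrite expgSr galM //; case: (integersK x).
have pow_f (z : kK) a : z ^+ (q ^ (a * f)) = z.
  elim: a => [|a IHa]; first by rewrite expr1.
  by rewrite mulSn expnD exprM -card_kK expf_card.
have f_gt0 : (0 < f)%N.
  by rewrite lt0n; apply: contraTneq (finNzRing_gt1 kK) => f0; rewrite card_kK f0.
(* With r the remainder of the order of s modulo f, all q^f elements of [kK] are roots of X^(q^r) -
   X; if r > 0 this polynomial is nonzero of degree q^r < q^f. *)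
have f_dvd : (f %| #[s]%g)%N.
  have pow_s (z : kK) : z ^+ (q ^ (#[s]%g %% f)) = z.
    have [x <-] := hK_surj z.
    rewrite -{1}[hK x](pow_f _ (#[s]%g %/ f)%N) -exprM -expnD -divn_eq -frob_iter expg_order.
    by congr (hK _); apply/val_inj; rewrite /= gal_id.
  rewrite /dvdn -leqn0 leqNgt; apply/negP => r_gt0.
  set m := (q ^ (#[s]%g %% f))%N in pow_s.
  have m_gt1 : (1 < m)%N by rewrite (ltn_exp2l 0) // -(expn0 q).
  have size_g : size ('X^m - 'X : {poly kK}) = m.+1.
    by rewrite size_polyDl size_polyXn // size_polyN size_polyX.
  have := @max_poly_roots _ ('X^m - 'X) (enum kK).
  rewrite -size_poly_eq0 size_g => /(_ isT _ (enum_uniq _)).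
  rewrite -cardE ltnS card_kK leq_exp2l // leqNgt ltn_mod f_gt0 => /(_ _)/negP; apply=> //.
  by apply/allP => z _; apply/rootP; rewrite !hornerE pow_s subrr.
exists (s ^+ (#[s]%g %/ f))%g; first exact: (groupX _ Ds).
by rewrite orderXdiv ?divnA ?mulKn ?order_gt0 // -{2}(divnK f_dvd) dvdn_mulr.
Qed.

End Frobenius.

(** * Inclusion of fractional ideals *)

Section FracOrder.

Local Open Scope classical_set_scope.
Variables (L : fieldExtType rat) (E : {subfield L}).
Implicit Types (A B C : set L) (I J : frac_ideal E).

Lemma frac_setD I J : frac_set (I + J) = ideal_mul (frac_set I) (frac_set J).
Proof. by []. Qed.

Lemma frac_submodule I : submodule E (frac_set I).
Proof. by case: (fracP I). Qed.

Lemma ideal_mulS A B C : A `<=` B -> ideal_mul A C `<=` ideal_mul B C.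
Proof.
move=> AB; apply: ideal_mul_sub; [exact: ideal_mul0 | exact: ideal_mulD |].
by move=> a c /AB Ba Cc; exact: mem_ideal_mul.
Qed.

(** To contain is to divide: multiply by the inverse of J, or back by J. Ideals are written
    additively, so [I - J] is a quotient. *)
Lemma frac_subP I J : frac_set I `<=` frac_set J <-> frac_set (I - J) `<=` integers E.
Proof.
rewrite frac_setD; split=> [IJ|IJ].
  have -> : integers E = ideal_mul (frac_set J) (frac_set (- J)).
    by rewrite -frac_setD subrr.
  exact: ideal_mulS.
rewrite -(subrK J I) frac_setD -[X in _ `<=` X](ideal_mul1 (frac_submodule J)).
exact: ideal_mulS.
Qed.

Lemma integral_addf I J : frac_set I `<=` integers E -> frac_set J `<=` integers E ->
  frac_set (I + J) `<=` integers E.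
Proof.
move=> IO JO; apply: ideal_mul_sub; [exact: integers0 | exact: integersD |].
by move=> a b /IO Oa /JO Ob; exact: integersM.
Qed.

Lemma integral_sumf (s : seq (frac_ideal E)) :
  {in s, forall J, frac_set J `<=` integers E} ->
  frac_set (\sum_(J <- s) J) `<=` integers E.
Proof.
move=> sO; rewrite big_seq; apply: (big_ind (fun J => frac_set J `<=` integers E)).
- by move=> x.
- by move=> I J; exact: integral_addf.
- exact: sO.
Qed.

Lemma prime_mul_sub A B P : prime_ideal E P ->
  A `<=` integers E -> B `<=` integers E -> ideal_mul A B `<=` P ->
  A `<=` P \/ B `<=` P.
Proof.
move=> [_ _ _ _ Pprime] AO BO ABP.
have [AP|/existsNP[a /not_implyP[Aa Pa]]] := pselect (A `<=` P); [by left | right].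
move=> b Bb; have : P (a * b) by apply: ABP; exact: mem_ideal_mul.
by case/Pprime => //; [exact: AO | exact: BO].
Qed.

Fact principal_frac_subproof a : integers E a -> a != 0 -> frac_ideal_pred E (principal_set E a).
Proof.
move=> Oa a0.
have sub b : b \in E -> submodule E (principal_set E b).
  move=> Eb; split.
  - by move=> _ [x [Ex _] <-]; exact: rpredM.
  - by exists 0; [exact: integers0 | rewrite mulr0].
  - by move=> _ _ [x Ox <-] [y Oy <-]; exists (x + y); [exact: integersD | rewrite mulrDr].
  - by move=> c _ Oc [x Ox <-]; exists (c * x); [exact: integersM | rewrite mulrCA].
have mem b : principal_set E b b by exists 1; [exact: integers1 | rewrite mulr1].
have Ea : a \in E by case: Oa.
have fa : fractional E (principal_set E a).
  split; [exact: sub | by exists a |].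
  exists 1; split; [exact: integers1 | exact: oner_neq0 |].
  by move=> _ [x Ox <-]; rewrite mul1r; exact: integersM.
apply/asboolP; split=> //; exists (principal_set E a^-1).
  split; [by apply: sub; rewrite rpredV | by exists a^-1; rewrite ?invr_eq0 |].
  by exists a; split=> // _ [x Ox <-]; rewrite mulVKf.
rewrite principal_mul; last by apply: sub; rewrite rpredV.
apply/seteqP; split=> [_ [_ [x Ox <-] <-]|x Ox]; first by rewrite mulVKf.
by exists (a^-1 * x); [exists x | rewrite mulVKf].
Qed.

Definition principal_frac a (Oa : integers E a) (a0 : a != 0) : frac_ideal E :=
  FracIdeal (principal_frac_subproof Oa a0).

Lemma principal_frac_sub a (Oa : integers E a) (a0 : a != 0) I :
  frac_set I a -> frac_set (principal_frac Oa a0) `<=` frac_set I.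
Proof.
by move=> Ia _ [x Ox <-]; rewrite mulrC; case: (frac_submodule I) => _ _ _; apply.
Qed.

Lemma mem_principal_frac a (Oa : integers E a) (a0 : a != 0) :
  frac_set (principal_frac Oa a0) a.
Proof. by exists 1; [exact: integers1 | rewrite mulr1]. Qed.

Lemma ideal_class_eq0 I : (ideal_class I = 0) <-> principal I.
Proof.
have <- : ideal_class (0 : frac_ideal E) = 0 by exact: raddf0.
split=> [/eqP|I0]; first by rewrite -Quotient.idealrBE subr0.
by apply/eqP; rewrite -Quotient.idealrBE subr0.
Qed.

(** By induction I = B S with B integral and S the product of the tail. The prime J contains B S but
    not S, so it contains B, and I lies in J S. The third hypothesis makes the primes pairwise
    incomparable. *)
Lemma sub_sum_primes I (s : seq (frac_ideal E)) : uniq s ->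
  {in s, forall J, prime_ideal E (frac_set J)} ->
  {in s &, forall J J', frac_set J `<=` frac_set J' -> J = J'} ->
  {in s, forall J, frac_set I `<=` frac_set J} ->
  frac_set I `<=` integers E ->
  frac_set I `<=` frac_set (\sum_(J <- s) J).
Proof.
move=> us prime_s anti_s I_s IO; elim: s us prime_s anti_s I_s => [|J s IHs] /=.
  by rewrite big_nil.
move=> /andP[Js us] prime_s anti_s I_s; rewrite big_cons.
have s_sub : {subset s <= J :: s} by move=> J' ?; rewrite inE; apply/orP; right.
have JJs := mem_head J s.
have integral_s J' : J' \in s -> frac_set J' `<=` integers E.
  by move=> /s_sub /prime_s[].
set S := \sum_(J <- s) J.
have IS : frac_set I `<=` frac_set S.
  apply: IHs => //; first by move=> J' /s_sub; exact: prime_s.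
    by move=> J1 J2 /s_sub s1 /s_sub; exact: anti_s.
  by move=> J' /s_sub; exact: I_s.
have SO : frac_set S `<=` integers E.
  exact: integral_sumf.
have [_ _ _ J1 _] := prime_s _ JJs.
have SJ : ~ frac_set S `<=` frac_set J.
  (* If J contained the product it would contain some factor, equal to J by [anti_s], against
     [Js]. *)
  have /(_ s) aux : forall s', {subset s' <= s} -> ~ frac_set (\sum_(J <- s') J) `<=` frac_set J.
    elim=> [|J' s' IHs'] ss'.
      by rewrite big_nil => /(_ _ (integers1 E)).
    have J's : J' \in s by apply: ss'; rewrite mem_head.
    rewrite big_cons => /(prime_mul_sub (prime_s _ JJs)) [||J'J|]; last first.
    - by apply: IHs' => J'' ?; apply: ss'; rewrite inE; apply/orP; right.
    - by move: Js; rewrite -(anti_s J' J) ?J's // s_sub.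
    - apply: integral_sumf => J'' J''s; apply: integral_s; apply: ss'.
      by rewrite inE; apply/orP; right.
    - exact: integral_s.
  exact: aux.
have IJ := I_s _ JJs.
move/frac_subP: IS => BO.
have := prime_mul_sub (prime_s _ JJs) BO SO.
rewrite -frac_setD subrK => /(_ IJ)[|//] /frac_subP BJ.
by apply/frac_subP; rewrite opprD addrA addrAC.
Qed.

Lemma prime_maximal P x : prime_ideal E P -> integers E x -> ~ P x ->
  exists2 u, integers E u & P (u * x - 1).
Proof.
move=> primeP Ox Px; have [k [h [h_surj h0]]] := residue_field primeP.
have hx : h (to_int Ox) != 0 by apply/eqP => /h0.
have [u hu] := h_surj (h (to_int Ox))^-1.
exists (val u); first exact: integersK.
have : h (u * to_int Ox - 1) = 0 by rewrite rmorphB rmorphM rmorph1 hu mulVf ?subrr.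
by move/h0.
Qed.

End FracOrder.

(** * The product of the conjugates of a prime *)

Section PolyCoefficients.

Local Open Scope classical_set_scope.
Variables (L : fieldExtType rat) (K : {subfield L}).

(** Below the leading one, the coefficients are up to sign elementary symmetric functions of
    positive degree in the [a j]. *)
Lemma prod_XsubC_coef (A : set L) (I : Type) (r : seq I) (Q : pred I) (a : I -> L) :
  submodule K A -> A `<=` integers K -> (forall j, Q j -> A (a j)) ->
  forall (g : {poly L}) i, g = \prod_(j <- r | Q j) ('X - (a j)%:P) ->
  (i < (size g).-1)%N -> A g`_i.
Proof.
move=> [_ A0 AD AM] AO Aa g + gE.
(* Integrality of all coefficients is carried along because the coefficient h_(i-1) - a h_i of (X -
   a) h may involve the leading coefficient of h, which need not lie in A. *)
suff [_ _] : [/\ g \is monic, forall i, integers K g`_i &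
    forall i, (i < (size g).-1)%N -> A g`_i] by apply.
rewrite gE; elim/big_rec: _ => [|j h Qj [mh Oh Ah]].
  split=> [|i|i]; [exact: monic1 | rewrite coef1 | by rewrite size_poly1].
  by case: (i == 0%N); [exact: integers1 | exact: integers0].
have ANa : A (- a j) by rewrite -mulN1r; apply: AM; [|exact: Aa];
  split; [rewrite rpredN mem1v | apply: integral_opp; exact: integral1].
have coef_i i : (('X - (a j)%:P) * h)`_i = (if i == 0%N then 0 else h`_i.-1) + h`_i * - a j.
  by rewrite mulrBl coefB coefXM coefCM mulrN [h`_i * _]mulrC.
split.
- by rewrite monicMl ?monicXsubC.
- move=> i; rewrite coef_i; apply: integersD; last by apply: integersM; rewrite ?Oh //; exact: AO.
  by case: (i == 0%N); [exact: integers0 | exact: Oh].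
- move=> i; rewrite size_monicM ?monicXsubC ?monic_neq0 // size_XsubC coef_i => i_lt.
  apply: AD; last exact: AM.
  by case: i i_lt => //= i i_lt; apply: Ah; rewrite -subn1 ltn_subRL.
Qed.

End PolyCoefficients.

Section Orbit.

Local Open Scope classical_set_scope.
Variables (L : splittingFieldType rat) (F K : {subfield L}).
Implicit Types (s t : gal_of K) (I J : frac_ideal K).

Lemma gal_fracD s : {morph gal_frac s : I J / I + J}.
Proof. by move=> I J; apply: frac_inj; exact: gal_ideal_mul. Qed.

Lemma gal_frac0 s : gal_frac s 0 = 0.
Proof. by rewrite -[X in gal_frac s X](subrr 0) gal_fracB subrr. Qed.

Lemma frac_sub_field I : frac_set I `<=` [set x | x \in K].
Proof. by case: (frac_submodule I). Qed.

Lemma gal_fracM s t I : gal_frac (s * t)%g I = gal_frac t (gal_frac s I).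
Proof. by apply: frac_inj; apply: image_galM; exact: frac_sub_field. Qed.

Lemma gal_frac1 I : gal_frac 1%g I = I.
Proof. by apply: frac_inj; exact: image_gal1. Qed.

Lemma gal_fracK s : cancel (gal_frac s) (gal_frac s^-1%g).
Proof. by move=> I; rewrite -gal_fracM mulgV gal_frac1. Qed.

(** Applying t^-1 turns the inclusion into one of a conjugate of I in I, to which [gal_sub_eq]
    applies. *)
Lemma gal_frac_sub_anti s t I :
  frac_set (gal_frac s I) `<=` frac_set (gal_frac t I) -> gal_frac s I = gal_frac t I.
Proof.
have IK := @frac_sub_field I; have sK := @frac_sub_field (gal_frac s I).
move=> st; suff {2}<- : gal_frac (s * t^-1)%g I = I by rewrite -gal_fracM mulgKV.
apply/frac_inj/gal_sub_eq => //=; rewrite image_galM //.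
rewrite -[X in _ `<=` X](@image_gal1 _ K) -(mulgV t) image_galM //.
exact: image_subset.
Qed.

Lemma gal_prime s P : prime_ideal K P -> prime_ideal K (s @` P).
Proof.
have gal_inv x : integers K x -> s ((s^-1)%g x) = x.
  by case=> Kx _; rewrite -galM // mulVg gal_id.
move=> [smP PO [x Px x0] P1 Pprime]; split.
- exact: gal_submodule.
- by move=> _ [y /PO Oy <-]; exact: integers_gal.
- by exists (s x); [exists x | rewrite fmorph_eq0].
- by case=> y Py sy; apply: P1; rewrite -(fmorph_inj s (etrans sy (esym (rmorph1 s)))).
- move=> y z Oy Oz [w Pw]; rewrite -(gal_inv y) // -(gal_inv z) // -rmorphM => /fmorph_inj wE.
  have [|||Py|Pz] := Pprime (s^-1%g y) (s^-1%g z); try exact: integers_gal.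
  + by rewrite -wE.
  + by left; exists (s^-1%g y).
  + by right; exists (s^-1%g z).
Qed.

(** [undup] keeps each conjugate once, so the sum over this list is the product Q of the distinct
    conjugates. *)
Definition gal_orbit I : seq (frac_ideal K) :=
  undup [seq gal_frac s I | s <- enum 'Gal(K / F)%g].

Lemma gal_orbitP I J :
  reflect (exists2 s, s \in 'Gal(K / F)%g & J = gal_frac s I) (J \in gal_orbit I).
Proof.
rewrite mem_undup; apply: (iffP mapP) => -[s Gs ->]; exists s => //.
  by rewrite mem_enum in Gs.
by rewrite mem_enum.
Qed.

Lemma gal_orbit_sum s I : s \in 'Gal(K / F)%g ->
  gal_frac s (\sum_(J <- gal_orbit I) J) = \sum_(J <- gal_orbit I) J.
Proof.
move=> Gs; rewrite (big_morph _ (gal_fracD s) (gal_frac0 s)).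
rewrite -(big_map (gal_frac s) xpredT id); apply: perm_big.
have us : uniq (map (gal_frac s) (gal_orbit I)).
  by rewrite map_inj_uniq ?undup_uniq //; exact: can_inj (gal_fracK s).
apply: uniq_perm => //; first exact: undup_uniq.
have [|_ eq_s] := uniq_min_size us _ (eq_leq (esym (size_map _ _))).
  move=> _ /mapP[_ /gal_orbitP[t Gt ->] ->]; apply/gal_orbitP.
  by exists (t * s)%g; rewrite ?groupM ?gal_fracM.
exact: eq_s.
Qed.

Hypothesis galKF : galois F K.
Variable I : frac_ideal K.
Hypothesis primeI : prime_ideal K (frac_set I).
Let P := frac_set I.
Let p := prime_below F P.
Let Q := \sum_(J <- gal_orbit I) J.

Let prime_orbit J : J \in gal_orbit I -> prime_ideal K (frac_set J).
Proof. by case/gal_orbitP=> s _ ->; exact: gal_prime. Qed.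

Let IinOrbit : I \in gal_orbit I.
Proof. apply/gal_orbitP; exists 1%g; [exact: group1 | by rewrite gal_frac1]. Qed.

Let integral_orbit J : J \in gal_orbit I -> frac_set J `<=` integers K.
Proof. by case/prime_orbit. Qed.

Lemma fixed_gal_below s x : s \in 'Gal(K / F)%g -> x \in F -> s x = x.
Proof. by move=> Gs Fx; case/and3P: galKF => sFK _ _; apply: fixed_gal Gs Fx. Qed.

(** Being fixed by the group, an element of p lies in every conjugate of P, and these are pairwise
    incomparable primes. *)
Lemma principal_sub_orbit_sum a (Oa : integers K a) (a0 : a != 0) : p a ->
  frac_set (principal_frac Oa a0) `<=` frac_set Q.
Proof.
case=> Pa [Fa _]; apply: sub_sum_primes.
- exact: undup_uniq.
- exact: prime_orbit.
- by move=> _ _ /gal_orbitP[s _ ->] /gal_orbitP[t _ ->]; exact: gal_frac_sub_anti.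
- move=> _ /gal_orbitP[s Gs ->]; apply: principal_frac_sub.
  by exists a; rewrite // fixed_gal_below.
- by apply: (@principal_frac_sub _ _ _ _ _ 0).
Qed.

Let QO : frac_set Q `<=` integers K.
Proof. exact: integral_sumf. Qed.

Let QI : frac_set (Q - I) `<=` integers K.
Proof.
rewrite /Q (big_rem I) // addrC addKr; apply: integral_sumf => J /mem_rem.
exact: integral_orbit.
Qed.

Lemma cofactor_below a (Oa : integers K a) (a0 : a != 0) : p a -> ~ frac_set (I + I) a ->
  exists x, [/\ integers F x, ~ P x & frac_set (principal_frac Oa a0 - Q) x].
Proof.
move=> pa a_sq; set A := principal_frac Oa a0; set C := A - Q.
have Fa : a \in F by case: pa => _ [].
have CO : frac_set C `<=` integers K by apply/frac_subP/principal_sub_orbit_sum.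
have gal_C s : s \in 'Gal(K / F)%g -> gal_frac s C = C.
  move=> Gs; rewrite gal_fracB gal_orbit_sum //; congr (_ - _); apply: frac_inj => /=.
  apply/seteqP; split=> [_ [_ [x Ox <-] <-]|_ [x Ox <-]].
    by rewrite rmorphM /= fixed_gal_below //; exists (s x); first exact: integers_gal.
  move: Ox; rewrite -{1}(gal_integers s) => -[y Oy <-].
  by exists (a * y); [exists y | rewrite rmorphM /= fixed_gal_below].
(* Otherwise a P^-2 = (C P^-1)(Q P^-1) would be integral and a would lie in P^2. *)
have /existsNP[c /not_implyP[Cc Pc]] : ~ frac_set C `<=` P.
  move=> /frac_subP CI; apply: a_sq.
  suff : frac_set A `<=` frac_set (I + I) by apply; exact: mem_principal_frac.
  apply/frac_subP; have -> : A - (I + I) = (C - I) + (Q - I).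
    by rewrite addrACA subrK -opprD.
  exact: integral_addf.
have Oc := CO _ Cc; have [[PK P0 PD PM] PO _ P1 Pprime] := primeI.
pose g := gal_poly F K c.
have mg : g \is monic by rewrite monic_prod // => s _; exact: monicXsubC.
have gc : g.[c] = 0.
  apply/rootP; rewrite /g /gal_poly (bigD1 1%g) ?group1 //= rootM root_XsubC gal_id.
  by rewrite eqxx.
have Cg i : (i < (size g).-1)%N -> frac_set C g`_i.
  apply: (prod_XsubC_coef (frac_submodule C) CO (Q := fun s => s \in 'Gal(K / F)%g)) erefl => s Gs.
  by rewrite -(gal_C s Gs); exists c.
have Fg i : integers F g`_i by exact: gal_poly_coef.
(* If all lower coefficients were in P, the equation g(c) = 0 would put a power of c, hence c, in
   P. *)
have [i [i_lt Pgi]] : exists i, (i < (size g).-1)%N /\ ~ P g`_i.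
  apply: contrapT => /forallNP no_i; apply: Pc.
  have Pg i : (i < (size g).-1)%N -> P g`_i.
    by move=> i_lt; have /not_andP[//|/contrapT] := no_i i.
  have OX n : integers K (c ^+ n).
    by elim: n => [|n IHn]; [exact: integers1 | rewrite exprS; exact: integersM].
  have : P (c ^+ (size g).-1).
    have := gc; rewrite horner_coef -(prednK (n := size g)) ?lt0n ?size_poly_eq0 ?monic_neq0 //.
    rewrite big_ord_recr /= -/(lead_coef g) (monicP mg) mul1r => /eqP.
    rewrite addrC addr_eq0 => /eqP ->; rewrite -mulN1r; apply: (PM).
      by split; [rewrite rpredN mem1v | apply: integral_opp; exact: integral1].
    by apply: (big_ind P) => // j _; rewrite mulrC; apply: (PM) => //; exact: Pg.
  by elim: (size g).-1 => [//|n IHn]; rewrite exprS => /Pprime[].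
by exists g`_i; split=> //; exact: Cg.
Qed.
End Orbit.

(** * Invertibility of the prime below P, and principality of Q *)

Section PrimeBelow.

Local Open Scope classical_set_scope.
Variables (L : splittingFieldType rat) (F K : {subfield L}).
Hypothesis galKF : galois F K.
Variable I : frac_ideal K.
Hypothesis primeI : prime_ideal K (frac_set I).
Let P := frac_set I.
Let p := prime_below F P.
Let Q := \sum_(J <- gal_orbit F I) J.

Let primep : prime_ideal F p.
Proof. exact: prime_below_ideal galKF primeI. Qed.

Lemma integersN (E : {subfield L}) x : integers E x -> integers E (- x).
Proof. by case=> Ex ix; split; [rewrite rpredN | exact: integral_opp]. Qed.

Lemma submoduleB (E : {subfield L}) A x y : submodule E A -> A x -> A y -> A (x - y).
Proof.
case=> _ _ AD AM Ax Ay; apply: AD => //; rewrite -mulN1r; apply: AM => //.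
exact: integersN (integers1 E).
Qed.

(** The inverse is the colon ideal [p']. For x given by [cofactor_below], x / a lies in [p'], so p
    p' contains x, which is outside p, together with p; maximality of p gives O_F. *)
Lemma prime_below_frac a : p a -> a != 0 -> ~ frac_set (I + I) a -> frac_ideal_pred F p.
Proof.
move=> pa a0 a_sq; have [sp pO [b pb b0] p1 _] := primep; have [pF p0 pD pM] := sp.
have OFK x : integers F x -> integers K x by exact: integersS.
have Oa : integers K a by case: pa => _ /OFK.
have [x [Ox Px Cx]] := cofactor_below galKF primeI Oa a0 pa a_sq.
have fp : fractional F p.
  split=> //; first by exists b.
  exists 1; split; [exact: integers1 | exact: oner_neq0 |].
  by move=> y /pO; rewrite mul1r.
pose p' : set L := [set y | y \in F /\ forall z, p z -> integers F (y * z)].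
have fp' : fractional F p'.
  split; first split.
  - by move=> y [].
  - by split=> [|z _]; [exact: mem0v | rewrite mul0r; exact: integers0].
  - move=> y z [Fy py] [Fz pz]; split=> [|w pw]; first exact: rpredD.
    by rewrite mulrDl; apply: integersD; [exact: py | exact: pz].
  - move=> c y Oc [Fy py]; split=> [|w pw]; first by apply: rpredM => //; case: Oc.
    by rewrite -mulrA; apply: integersM => //; exact: py.
  - exists 1; last exact: oner_neq0.
    by split=> [|z pz]; [exact: mem1v | rewrite mul1r; exact: pO].
  - by exists a; split=> [||y [_ py]]; [exact: pO | | rewrite mulrC; exact: py].
apply/asboolP; split=> //; exists p' => //; apply/seteqP; split.
  apply: ideal_mul_sub; [exact: integers0 | exact: integersD |].
  by move=> y z py [_ pz]; rewrite mulrC; exact: pz.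
have Fa : a \in F by case: pa => _ [].
(* An element y of p lies in Q and x lies in a Q^-1, so x y is in a O_K; moreover x y / a is in
   F. *)
have p'x : p' (x / a).
  split=> [|y py]; first by rewrite rpred_div //; case: Ox.
  have [-> | y0] := eqVneq y 0; first by rewrite mulr0; exact: integers0.
  have Oy : integers K y by case: py => _ /OFK.
  have Qy : frac_set Q y.
    apply: (principal_sub_orbit_sum galKF primeI (Oa := Oy) (a0 := y0) py).
    exact: mem_principal_frac.
  have : frac_set (principal_frac Oa a0 - Q + Q) (x * y) by exact: mem_ideal_mul.
  rewrite subrK => -[z [_ iz] zE].
  have <- : z = x / a * y by rewrite mulrAC -zE mulrC mulKf.
  split=> //; have -> : z = x / a * y by rewrite mulrAC -zE mulrC mulKf.
  by rewrite rpredM ?rpred_div //; [case: Ox | case: py => _ []].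
have pp'x : ideal_mul p p' x by rewrite -(divfK a0 x) mulrC; exact: mem_ideal_mul.
have pp'p y : p y -> ideal_mul p p' y.
  move=> py; rewrite -[y]mulr1; apply: mem_ideal_mul => //.
  by split=> [|z pz]; [exact: mem1v | rewrite mul1r; exact: pO].
have [spp' _ _] := fractional_mul fp fp'; have [_ _ _ ppM] := spp'.
have [u Ou pu] : exists2 u, integers F u & p (u * x - 1).
  by apply: (prime_maximal primep) => // -[].
move=> y Oy; rewrite -[y]mulr1; apply: (ppM) => //.
by rewrite -(subKr (u * x) 1); apply: (submoduleB spp'); [exact: ppM | exact: pp'p].
Qed.

(** If p lay in P^2, so would p O_K, and multiplying by the inverse of P^2 would give an integral
    cofactor: P^2 would divide p O_K. *)
Lemma unramified_not_square : unramified F K P -> exists2 a, p a & ~ frac_set (I + I) a.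
Proof.
case=> _ unr; apply: contrapT => sub; apply: unr.
have p_sq a : p a -> frac_set (I + I) a.
  by move=> pa; apply: contrapT => a_sq; apply: sub; exists a.
have [sE0 sE1 sE2 sE3] := frac_submodule (I + I).
have ext_sub : extended_below F K P `<=` frac_set (I + I).
  apply: ideal_mul_sub => // a b /p_sq Ia Ob; rewrite mulrC; exact: sE3.
exists (ideal_mul (extended_below F K P) (frac_set (- (I + I)))); first split.
- have [JK J0 JD JM] := frac_submodule (- (I + I)); split.
  + apply: ideal_mul_sub; [exact: mem0v | by move=> x y; exact: rpredD |].
    by move=> x y /ext_sub/sE0 Kx /JK Ky; exact: rpredM.
  + exact: ideal_mul0.
  + exact: ideal_mulD.
  + move=> c x Oc; move: x; apply: ideal_mul_sub.
    * by rewrite mulr0; exact: ideal_mul0.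
    * by move=> x y ? ?; rewrite mulrDr; exact: ideal_mulD.
    * by move=> x y ? ?; rewrite mulrCA; apply: mem_ideal_mul => //; exact: JM.
- have -> : integers K = ideal_mul (frac_set (I + I)) (frac_set (- (I + I))).
    by rewrite -frac_setD subrr.
  exact: ideal_mulS.
have -> : ideal_exp K P 2 = frac_set (I + I).
  by rewrite /ideal_exp /= [X in ideal_mul _ X]ideal_mulC ideal_mul1 //; exact: frac_submodule.
rewrite ideal_mulC -ideal_mulA -(frac_setD (- _)) addNr /extended_below.
rewrite -ideal_mulA ideal_mul1 //; by case: (fractional_integers K).
Qed.

Lemma orbit_sum_class0 (ClF_trivial : forall c : class_group F, c = 0) :
  unramified F K P -> ideal_class Q = 0.
Proof.
move=> unr; have [a pa a_sq] := unramified_not_square unr.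
have a0 : a != 0.
  by apply: contra_notN a_sq => /eqP ->; case: (frac_submodule (I + I)).
have /ideal_class_eq0/asboolP[w [Fw w0 /= pE]] :
  ideal_class (FracIdeal (prime_below_frac pa a0 a_sq)) = 0 by exact: ClF_trivial.
have pw : p w by rewrite pE; exists 1; [exact: integers1 | rewrite mulr1].
have Ow : integers K w by case: pw => _; exact: integersS.
have w_sq : ~ frac_set (I + I) w.
  move=> w_sq; apply: a_sq; move: pa; rewrite pE => -[y Oy <-]; rewrite mulrC.
  by have [_ _ _] := frac_submodule (I + I); apply=> //; exact: integersS Oy.
have [x [Ox Px Cx]] := cofactor_below galKF primeI Ow w0 pw w_sq.
set W := principal_frac Ow w0 in Cx.
have [sp pO _ p1 _] := primep.
have [u Ou pu] : exists2 u, integers F u & p (u * x - 1).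
  by apply: (prime_maximal primep) => // -[].
have QO : frac_set Q `<=` integers K.
  by apply: integral_sumf => J /gal_orbitP[s _ ->]; case: (gal_prime s primeI).
(* One inclusion is that w, being in p, lies in Q. For the other, w Q^-1 contains x and w O_K, hence
   1 by maximality of p, so its inverse Q w^-1 is integral. *)
have WQ : frac_set W `<=` frac_set Q by exact: principal_sub_orbit_sum.
have WC : frac_set W `<=` frac_set (W - Q) by apply/frac_subP; rewrite opprB addrC subrK.
have C1 : frac_set (W - Q) 1.
  rewrite -(subKr (u * x) 1); apply: submoduleB; first exact: frac_submodule.
    by have [_ _ _] := frac_submodule (W - Q); apply=> //; exact: integersS Ou.
  apply: WC; move: pu; rewrite pE => -[y Oy <-]; exists y => //; exact: integersS Oy.
have QW : frac_set Q `<=` frac_set W.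
  apply/frac_subP; have -> : Q - W = 0 - (W - Q) by rewrite sub0r opprB.
  apply/frac_subP => y Oy; rewrite -[y]mulr1.
  by have [_ _ _] := frac_submodule (W - Q); apply.
apply/ideal_class_eq0/asboolP; exists w; split=> //; first by have [] := Ow.
by apply/seteqP.
Qed.

End PrimeBelow.

(** * Annihilation *)

(** A is a union of right cosets of H, each of which meets T in a single element; count coset by
    coset. *)
Lemma card_transversal_setI (gT : finGroupType) (G H : {group gT}) (T A : {set gT}) :
  is_transversal T (rcosets H G) G -> A \subset G ->
  {in H, forall h x, (h * x \in A)%g = (x \in A)} -> (#|A| = #|H| * #|T :&: A|)%N.
Proof.
case/and3P=> partG TG /forall_inP T1 AG HA.
have card_sum (B : {set gT}) : B \subset G ->
    #|B| = (\sum_(C in rcosets H G) \sum_(x in C) (x \in B))%N.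
  move=> BG; rewrite -(set_partition_big _ partG) -sum1_card [RHS]big_mkcond [LHS]big_mkcond /=.
  by apply: eq_bigr => x _; case: (boolP (x \in B)) => [/(fintype.subsetP BG) -> | _] //; case: ifP.
rewrite (card_sum _ AG) (card_sum _ (fintype.subset_trans (finset.subsetIr T A) AG)) big_distrr /=.
apply: eq_bigr => C HC; have /cards1P[t Tt] := T1 C HC.
have tC : t \in C by have : t \in T :&: C; [rewrite Tt set11 | case/setIP].
have tT : t \in T by have : t \in T :&: C; [rewrite Tt set11 | case/setIP].
have CE : C = (H :* t)%g.
  by case/rcosetsP: HC tC => g _ -> /rcoset_eqP.
have -> : (\sum_(x in C) (x \in T :&: A) = (t \in A))%N.
  rewrite (bigD1 t) //= inE tT big1 ?addn0 // => x /andP[xC xt]; rewrite inE.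
  have : (x \in T :&: C) = (x == t) by rewrite Tt inE.
  by rewrite inE xC andbT (negPf xt) => ->.
rewrite (eq_bigr (fun=> (t \in A : nat))); first by rewrite sum_nat_const CE card_rcoset.
by move=> x; rewrite CE => /rcosetP[h Hh ->]; rewrite HA.
Qed.

Section Annihilation.

Local Open Scope classical_set_scope.
Variables (L : splittingFieldType rat) (F K : {subfield L}).

Lemma gal_classB s : {morph @gal_class L K s : c d / c - d}.
Proof.
move=> c d; elim/quotW: c => I; elim/quotW: d => J.
rewrite -raddfB /= -![\pi _]/(ideal_class _) !gal_class_pi gal_fracB.
exact: raddfB.
Qed.

Lemma group_ring_actB z : {morph @group_ring_act L K z : c d / c - d}.
Proof.
move=> c d; rewrite /group_ring_act -sumrB; apply: eq_bigr => s _.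
by rewrite gal_classB mulrzBl.
Qed.

Lemma theta_act (T : {set gal_of K}) I :
  group_ring_act (theta T) (ideal_class I) = \sum_(s in T) ideal_class (gal_frac s I).
Proof.
rewrite /group_ring_act [RHS]big_mkcond; apply: eq_bigr => s _; rewrite gal_class_pi.
rewrite /theta sum_ffunE; case: ifP => Ts.
  rewrite (bigD1 s) //= ffunE eqxx big1 ?addr0 ?mulr1z // => t /andP[_ ts].
  by rewrite ffunE eq_sym (negPf ts).
rewrite big1 ?mulr0z // => t Tt; rewrite ffunE.
by case: eqVneq Tt => // <-; rewrite Ts.
Qed.

Lemma cyclic_core_group f : exists H : {group gal_of K}, cyclic_core F K f = H.
Proof.
by eexists ('Gal(K / F) :&: \bigcap_(C : {group gal_of K} | _) C)%G.
Qed.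

(** The s in T giving a fixed conjugate t I are those in the coset D t of the stabilizer D. As H
    lies in D, there are [D : H] of them, whatever t. *)
Lemma sum_transversal_class (H : {group gal_of K}) (T : {set gal_of K}) (I : frac_ideal K) :
  coset_reps F H T -> H \subset stabilizer F K (frac_set I) ->
  exists m, \sum_(s in T) ideal_class (gal_frac s I)
    = ideal_class (\sum_(J <- gal_orbit F I) J) *+ m.
Proof.
move=> repsT HD; pose D := Group (stabilizer_group F (@frac_sub_field _ _ I)).
have stabP s : (s \in D) = (s \in 'Gal(K / F)%g) && (gal_frac s I == I).
  by rewrite inE.
pose A J := [set s in 'Gal(K / F)%g | gal_frac s I == J]%SET.
have TG : T \subset 'Gal(K / F)%g by case/and3P: repsT.
have cardA J : J \in gal_orbit F I -> #|T :&: A J| = (#|D| %/ #|H|)%N.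
  case/gal_orbitP=> t Gt ->.
  have AE : A (gal_frac t I) = (D :* t)%g.
    apply/setP => s; rewrite mem_rcoset stabP inE groupMr ?groupV //; congr (_ && _).
    by rewrite gal_fracM -[in LHS](can_eq (gal_fracK t^-1%g)) gal_fracK.
  rewrite -(card_rcoset D t) -AE [in RHS](card_transversal_setI repsT) ?mulKn //.
    by apply/fintype.subsetP => s; rewrite inE => /andP[].
  move=> h /(fintype.subsetP HD); rewrite -[h \in _]/(h \in D) stabP => /andP[Gh /eqP hI] s.
  by rewrite !inE groupMl // gal_fracM hI.
exists (#|D| %/ #|H|)%N; rewrite [ideal_class _]raddf_sum -sumrMnl /=.
(* The inner sum has exactly one term, since the orbit has no repetition; the two sums can then be
   exchanged. *)
transitivity (\sum_(s in T) \sum_(J <- gal_orbit F I | J == gal_frac s I) ideal_class J).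
  apply: eq_bigr => s Ts; rewrite -big_filter filter_pred1_uniq ?undup_uniq ?big_seq1 //.
  by apply/gal_orbitP; exists s => //; exact: fintype.subsetP TG s Ts.
rewrite (exchange_big_dep xpredT) //= !big_seq; apply: eq_bigr => J /cardA <-.
rewrite sumr_const; congr (_ *+ _); apply: eq_card => s.
rewrite !inE unfold_in eq_sym.
by case: (boolP (s \in T)) => [/(fintype.subsetP TG) -> |_].
Qed.

End Annihilation.

Theorem theorem1p3 (L : splittingFieldType rat) (F K : {subfield L})
  (galKF : galois F K)
  (ClF_trivial : forall c : class_group F, c = 0)
  (f : nat) (Rf : generating_degrees F K f)
  (T : {set gal_of K}) (repsT : coset_reps F (cyclic_core F K f) T) :
  annihilates_class_group (theta T).
Proof.
case: Rf => _ gen c; pose S (d : class_group K) := group_ring_act (theta T) d = 0.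
(* The classes killed by [theta T] form a subgroup, so it suffices to treat the generating classes
   of primes. *)
suff sub : (degree_classes F f `<=` S)%classic.
  have : (smallest (@is_subgroup _) (degree_classes F f)) c by rewrite gen.
  move=> /(_ S); apply; split=> //; split=> [|d e]; rewrite /S /=.
    by rewrite -[X in group_ring_act _ X](subrr 0) group_ring_actB subrr.
  by move=> d0 e0; rewrite group_ring_actB d0 e0 subrr.
move=> d [P [primeI unr resdeg [I IP ->]]]; rewrite /S theta_act.
rewrite -{}IP in primeI unr resdeg.
have [H HE] := cyclic_core_group F K f; rewrite HE in repsT.
have [s Ds os] := order_stabilizer_elt galKF primeI resdeg.
have Gs : s \in 'Gal(K / F)%g by move: Ds; rewrite inE => /andP[].
(* The cyclic group generated by s has order f, so it is one of those intersected in H_f, and it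
   lies in the decomposition group. *)
have HD : H \subset stabilizer F K (frac_set I).
  rewrite -HE; apply: (@fintype.subset_trans _ _ <[s]>%g).
    apply: fintype.subset_trans (finset.subsetIr _ _) _; apply: (finset.bigcap_inf <[s]>%G) => /=.
    by rewrite cycle_subG Gs cycle_cyclic -orderE os eqxx.
  by rewrite (cycle_subG s (Group (stabilizer_group F (@frac_sub_field _ _ I)))).
have [m ->] := sum_transversal_class repsT HD.
by rewrite orbit_sum_class0 ?mul0rn.
Qed.
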